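(* The value $\rho$ of the conical escape rate game has the following dual characterization: \[ \rho=\inf\{\lambda\in\mathbb{R}\mid \exists\, v\in\mathscr{D}_C,\ Sv\leq\lambda+v\}, \] the inequality $Sv\leq\lambda+v$ being pointwise on $C\setminus\{0\}$.
   Context: A proper cone $C\subset\mathbb{R}^n$ is a convex, closed, pointed cone with nonempty interior $\mathrm{int}\,C$; $x\leq_C y$ means $y-x\in C$. The Funk hemi-metric on $\mathrm{int}\,C$ is $\mathrm{Funk}(x,y)=\log\inf\{\alpha>0\mid x\leq_C\alpha y\}$ (it satisfies the triangle inequality, and may be negative). Conical escape rate game: $\mathcal{A},\mathcal{B}$ are nonempty compact sets, and for each $(a,b)\in\mathcal{A}\times\mathcal{B}$, $T_{ab}:\mathrm{int}\,C\to\mathrm{int}\,C$ is order preserving ($x\leq_Cy\Rightarrow T_{ab}(x)\leq_CT_{ab}(y)$) and positively homogeneous of degree 1. Standing assumptions: (1) for all $x\in\mathrm{int}\,C$ the maps $b\mapsto T_{ab}(x)$ (each $a$) and $a\mapsto T_{ab}(x)$ (each $b$) are continuous, and for every compact $K\subset\mathrm{int}\,C$ the set $\{T_{ab}(x)\mid (a,b,x)\in\mathcal{A}\times\mathcal{B}\times K\}$ is compact; (2) each $T_{ab}$ extends continuously (for the Euclidean topology) to a map $C\to C$, still denoted $T_{ab}$, and the map $\mathcal{A}\times\mathcal{B}\times C\to C$, $(a,b,x)\mapsto T_{ab}(x)$ is continuous. From an initial state $x_0\in\mathrm{int}\,C$, at each turn $k\geq1$ player Min chooses $a_k\in\mathcal{A}$,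 then player Max, having observed $a_k$, chooses $b_k\in\mathcal{B}$, and $x_k=T_{a_kb_k}(x_{k-1})$. A strategy $\sigma$ of Min maps each finite history (of states and actions) to an element of $\mathcal{A}$; a strategy $\tau$ of Max maps each finite history together with Min's next action to an element of $\mathcal{B}$. The payoff is $J_\infty(\sigma,\tau)=\limsup_{k\to\infty}\mathrm{Funk}(x_k,x_0)/k$, minimized by Min and maximized by Max. The value is $\rho=\inf_\sigma\sup_\tau J_\infty(\sigma,\tau)=\sup_\tau\inf_\sigma J_\infty(\sigma,\tau)$; it exists and is independent of $x_0$. $\mathscr{D}_C$ is the set of functions $v:C\setminus\{0\}\to\mathbb{R}$ that are continuous for the Euclidean topology and whose restriction to $\mathrm{int}\,C$ is distance-like for the Funk metric, i.e. $v(x)-v(y)\leq\mathrm{Funk}(x,y)$ for all $x,y\in\mathrm{int}\,C$ and, for some $x_0\in\mathrm{int}\,C$ and $\alpha\in\mathbb{R}$, $v(x)\geq\alpha+\mathrm{Funk}(x,x_0)$ for all $x\in\mathrm{int}\,C$. By convention $v(0)=-\infty$. The Shapley operator is $Sv(x)=\inf_{a\in\mathcal{A}}\sup_{b\in\mathcal{B}}v(T_{ab}(x))$ for $x\in C\setminus\{0\}$. *)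

(* Defs.v *)
From mathcomp Require Export all_boot all_order all_algebra.
From mathcomp Require Export all_classical all_reals all_analysis.

Set Implicit Arguments.
Unset Strict Implicit.
Unset Printing Implicit Defensive.

Export Order.TTheory GRing.Theory Num.Theory.
Export numFieldNormedType.Exports.

Local Open Scope classical_set_scope.
Local Open Scope ring_scope.

(* The topology of 'rV[R]_n is the one of the sup norm, i.e. the Euclidean    *)
(* topology.                                                                  *)
Record proper_cone (R : realType) (n : nat) (C : set 'rV[R]_n) : Prop := {
  cone_scale : forall (t : R) (x : 'rV[R]_n), 0 <= t -> C x -> C (t *: x);
  cone_convex : convex_set C;
  cone_closed : closed C;
  cone_pointed : forall x : 'rV[R]_n, C x -> C (- x) -> x = 0;
  cone_interior : C° !=set0 }.

Definition cone_le (R : realType) (n : nat) (C : set 'rV[R]_n)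
    (x y : 'rV[R]_n) : Prop := C (y - x).

(* Meaningful for x and y in the interior of a proper cone of positive        *)
(* dimension: the infimum is then a positive real number.                     *)
Definition Funk (R : realType) (n : nat) (C : set 'rV[R]_n)
    (x y : 'rV[R]_n) : R :=
  ln (inf [set alpha : R | 0 < alpha /\ cone_le C x (alpha *: y)]).

(* T a b is a total function on R^n, of which only the values on C matter;    *)
(* on the interior of C it is the dynamics of the game, on C its continuous   *)
(* extension.                                                                 *)
Record conical_game (R : realType) (n : nat) (C : set 'rV[R]_n)
    (A B : topologicalType) (T : A -> B -> 'rV[R]_n -> 'rV[R]_n) : Prop := {
  min_actions_nonempty : [set: A] !=set0;
  min_actions_compact : compact [set: A];
  max_actions_nonempty : [set: B] !=set0;
  max_actions_compact : compact [set: B];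
  dyn_interior : forall a b (x : 'rV[R]_n), C° x -> C° (T a b x);
  dyn_order_preserving : forall a b (x y : 'rV[R]_n),
    C° x -> C° y -> cone_le C x y -> cone_le C (T a b x) (T a b y);
  dyn_homogeneous : forall a b (t : R) (x : 'rV[R]_n),
    0 < t -> C° x -> T a b (t *: x) = t *: T a b x;
  dyn_continuous_max : forall a (x : 'rV[R]_n), C° x -> continuous (fun b => T a b x);
  dyn_continuous_min : forall b (x : 'rV[R]_n), C° x -> continuous (fun a => T a b x);
  dyn_compact : forall K : set 'rV[R]_n, compact K -> K `<=` C° ->
    compact [set y | exists a b (x : 'rV[R]_n), K x /\ y = T a b x];
  dyn_cone : forall a b (x : 'rV[R]_n), C x -> C (T a b x);
  dyn_continuous_cone : forall a b, {within C, continuous (T a b)};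
  dyn_continuous_joint :
    {within [set p : A * B * 'rV[R]_n | C p.2],
      continuous (fun p : A * B * 'rV[R]_n => T p.1.1 p.1.2 p.2)} }.

(* (x_0, [:: (a_1, b_1, x_1); ...; (a_k, b_k, x_k)]) *)
Definition history (R : realType) (n : nat) (A B : Type) : Type :=
  'rV[R]_n * seq (A * B * 'rV[R]_n).

Definition min_strategy (R : realType) (n : nat) (A B : Type) : Type :=
  history R n A B -> A.

Definition max_strategy (R : realType) (n : nat) (A B : Type) : Type :=
  history R n A B -> A -> B.

Definition current_state (R : realType) (n : nat) (A B : Type)
    (h : history R n A B) : 'rV[R]_n := last h.1 [seq s.2 | s <- h.2].

Definition next_history (R : realType) (n : nat) (A B : Type)
    (T : A -> B -> 'rV[R]_n -> 'rV[R]_n)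
    (sigma : min_strategy R n A B) (tau : max_strategy R n A B)
    (h : history R n A B) : history R n A B :=
  let a := sigma h in
  let b := tau h a in
  (h.1, rcons h.2 (a, b, T a b (current_state h))).

Definition play_state (R : realType) (n : nat) (A B : Type)
    (T : A -> B -> 'rV[R]_n -> 'rV[R]_n) (x0 : 'rV[R]_n)
    (sigma : min_strategy R n A B) (tau : max_strategy R n A B) (k : nat) :
    'rV[R]_n :=
  current_state (iter k (next_history T sigma tau) (x0, [::])).

Definition payoff (R : realType) (n : nat) (C : set 'rV[R]_n) (A B : Type)
    (T : A -> B -> 'rV[R]_n -> 'rV[R]_n) (x0 : 'rV[R]_n)
    (sigma : min_strategy R n A B) (tau : max_strategy R n A B) : \bar R :=
  limn_esup (fun k : nat =>
    (Funk C (play_state T x0 sigma tau k) x0 / k%:R)%:E).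

Definition upper_value (R : realType) (n : nat) (C : set 'rV[R]_n)
    (A B : Type) (T : A -> B -> 'rV[R]_n -> 'rV[R]_n) (x0 : 'rV[R]_n) : \bar R :=
  ereal_inf [set ereal_sup [set payoff C T x0 sigma tau
                           | tau in [set: max_strategy R n A B]]
            | sigma in [set: min_strategy R n A B]].

Definition lower_value (R : realType) (n : nat) (C : set 'rV[R]_n)
    (A B : Type) (T : A -> B -> 'rV[R]_n -> 'rV[R]_n) (x0 : 'rV[R]_n) : \bar R :=
  ereal_sup [set ereal_inf [set payoff C T x0 sigma tau
                           | sigma in [set: min_strategy R n A B]]
            | tau in [set: max_strategy R n A B]].

Definition is_value (R : realType) (n : nat) (C : set 'rV[R]_n)
    (A B : Type) (T : A -> B -> 'rV[R]_n -> 'rV[R]_n) (rho : R) : Prop :=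
  forall x0 : 'rV[R]_n, C° x0 ->
    upper_value C T x0 = rho%:E /\ lower_value C T x0 = rho%:E.

(* A function on C \ {0} is encoded by a total function whose values outside  *)
(* C \ {0} are irrelevant.                                                    *)
Record distance_like_on_cone (R : realType) (n : nat) (C : set 'rV[R]_n)
    (v : 'rV[R]_n -> R) : Prop := {
  dl_continuous : {within C `\ 0, continuous v};
  dl_lipschitz : forall x y : 'rV[R]_n, C° x -> C° y -> v x - v y <= Funk C x y;
  dl_lower_bound : exists (x0 : 'rV[R]_n) (alpha : R), C° x0 /\
    forall x : 'rV[R]_n, C° x -> alpha + Funk C x x0 <= v x }.

(* v with the convention v(0) = -oo *)
Definition ext0 (R : realType) (n : nat) (v : 'rV[R]_n -> R)
    (x : 'rV[R]_n) : \bar R := if x == 0 then -oo%E else (v x)%:E.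

(* Extended-real valued: T a b may send a nonzero boundary point to 0. *)
Definition Shapley (R : realType) (n : nat) (A B : Type)
    (T : A -> B -> 'rV[R]_n -> 'rV[R]_n) (v : 'rV[R]_n -> R)
    (x : 'rV[R]_n) : \bar R :=
  ereal_inf [set ereal_sup [set ext0 v (T a b x) | b in [set: B]]
            | a in [set: A]].

(* Main.v *)
(* Fix an interior point e. Write M(x) = inf {t > 0 | x <= t e}, that is
   exp Funk(x, e), and let F f(x) = inf_a sup_b f(T_ab x) be the multiplicative
   Shapley operator (v = ln f), acting on the order preserving, positively
   homogeneous, continuous functions f on C. The value is
   rho = inf_k ln (F^k M)(e) / k.

   Upper bound: for lambda > rho choose K with (F^K M)(e) < exp(lambda K).
   Replacing F by F + eps M, which for eps small preserves this inequality,
   produces g_0 = M, ..., g_K, and w = min_{k < K} exp(-lambda k) g_k satisfies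
   F w <= exp(lambda) w on C and dominates a multiple of M, so that ln w is
   dual feasible. Conversely any dual feasible v gives Min a positional strategy
   along which v grows at each turn by at most lambda, up to an arbitrarily
   small error, so the upper value is at most lambda.

   Lower bound: for lambda < rho, the functions
   G_N = max_{k <= N} exp(-lambda k) F^k M have G_N(e) -> +oo, and
   h = limsup_N G_N / G_N(e) satisfies F h >= exp(lambda) h on int C by
   compactness of the action sets. As h <= M, playing greedily for h guarantees
   Max a payoff arbitrarily close to lambda. *)

Require Import Defs.
From mathcomp Require Import all_boot all_order all_algebra.
From mathcomp Require Import all_classical all_reals all_analysis.
From mathcomp Require Import ring lra.

Set Implicit Arguments.
Unset Strict Implicit.
Unset Printing Implicit Defensive.

Local Open Scope classical_set_scope.
Local Open Scope ring_scope.

(** * Geometry of proper cones *)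

Section Cone.
Context (R : realType) (n : nat) (C : set 'rV[R]_n).
Hypothesis properC : proper_cone C.
Implicit Types (x y z e : 'rV[R]_n) (t : R).

Let C_closed := cone_closed properC.

Lemma cone_add x y : C x -> C y -> C (x + y).
Proof.
move=> Cx Cy; have h : 0 <= (2^-1 : R) <= 1 by apply/andP; split; lra.
pose l : {i01 R} := Itv01 (proj1 (andP h)) (proj2 (andP h)).
have := cone_convex properC l (mem_set Cx) (mem_set Cy).
rewrite inE => /(cone_scale properC (ler0n R 2)); congr C.
have -> : conv l (x : convex_lmodType _) y = 2^-1 *: x + (1 - 2^-1) *: y by [].
have -> : 1 - 2^-1 = 2^-1 :> R by lra.
by rewrite -scalerDr scalerA mulfV ?scale1r.
Qed.

Lemma cone_int_sub x : C° x -> C x.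
Proof. exact: interior_subset. Qed.

Lemma cone_zero : C 0.
Proof.
have [x /cone_int_sub Cx] := cone_interior properC.
by rewrite -(scale0r x); apply: cone_scale.
Qed.

Lemma cone_scaleV t x : 0 < t -> C (t *: x) -> C x.
Proof.
move=> t0 /(cone_scale properC (t := t^-1)).
by rewrite scalerA mulVf ?gt_eqF// scale1r; apply; rewrite invr_ge0 ltW.
Qed.

Lemma cone_int_add x y : C x -> C° y -> C° (x + y).
Proof.
move=> Cx Cy; rewrite /interior /=.
have : z - x @[z --> (x + y)] --> (x + y) - x.
  exact: (cvgB cvg_id (cvg_cst _)).
rewrite [(x + y) - x]addrAC subrr add0r.
move=> /(_ C Cy); apply: (@filterS _ (nbhs (x + y))) => z /= Czx.
by rewrite -(subrK x z); apply: cone_add.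
Qed.

Lemma cone_int_scale t x : 0 < t -> C° x -> C° (t *: x).
Proof.
move=> t0 Cx; rewrite /interior /=.
have : t^-1 *: z @[z --> t *: x] --> t^-1 *: (t *: x).
  exact: (cvgZl_tmp cvg_id).
rewrite [t^-1 *: (t *: x)]scalerA mulVf ?gt_eqF// scale1r.
move=> /(_ C Cx); apply: (@filterS _ (nbhs (t *: x))) => z /= /cone_scaleV.
by apply; rewrite invr_gt0.
Qed.

Lemma cone_cvg x z : (forall t, 0 < t -> C (x + t *: z)) -> C x.
Proof.
move=> H; apply: (@closed_cvg _ _ (0^'+) _ (fun t => x + t *: z) C) => //.
  by near=> t; apply: H; near: t; exact: nbhs_right_gt.
have -> : nbhs x = nbhs (x + 0 *: z) by rewrite scale0r addr0.
apply: cvg_at_right_filter.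
exact: (cvgD (cvg_cst _) (cvgZr_tmp cvg_id)).
Unshelve. all: by end_near. Qed.

(** An interior point is an order unit: a ball of radius d around [e] lies in [C], so [e] minus a
    multiple of [z] of norm d / 2 does too, and rescaling gives r = 2 / d. *)
Lemma cone_absorb e : C° e ->
  exists2 r : R, 0 < r & forall z, C ((r * `|z|) *: e - z).
Proof.
move=> /nbhs_ballP[d /= d0 Cd]; exists (2 / d); first by rewrite divr_gt0.
move=> z; have [->|z0] := eqVneq z 0.
  by rewrite normr0 mulr0 scale0r subr0; exact: cone_zero.
have nz : 0 < `|z| by rewrite normr_gt0.
have /(cone_scale properC (t := 2 / d * `|z|)) :
    C (e - (d / (2 * `|z|)) *: z).
  apply: Cd; rewrite -ball_normE /= opprB addrC subrK normrZ.
  rewrite gtr0_norm ?divr_gt0 ?mulr_gt0//.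
  have -> : d / (2 * `|z|) * `|z| = d / 2 by field; rewrite gt_eqF.
  by lra.
rewrite scalerBr scalerA.
have -> : 2 / d * `|z| * (d / (2 * `|z|)) = 1 by field; rewrite !gt_eqF.
by rewrite scale1r; apply; rewrite mulr_ge0// divr_ge0// ltW.
Qed.

(* [Funk C x y] unfolds to [ln (cratio C x y)]. *)
Definition cratio x y : R :=
  inf [set alpha : R | 0 < alpha /\ cone_le C x (alpha *: y)].

Let cratio_lb x y :
  has_lbound [set alpha : R | 0 < alpha /\ cone_le C x (alpha *: y)].
Proof. by exists 0 => t [/ltW]. Qed.

Let cratio_nonempty x y : C° y ->
  [set alpha : R | 0 < alpha /\ cone_le C x (alpha *: y)] !=set0.
Proof.
move=> Cy; have [r r0 /(_ x) Cr] := cone_absorb Cy.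
exists (r * `|x| + 1); split; first by rewrite ltr_wpDl// mulr_ge0// ltW.
rewrite /cone_le scalerDl scale1r addrAC; apply: cone_add => //.
exact: cone_int_sub.
Qed.

Lemma cratio_ge0 x y : C° y -> 0 <= cratio x y.
Proof.
by move=> Cy; apply: lb_le_inf; [exact: cratio_nonempty|move=> t [/ltW]].
Qed.

(** The infimum is attained: every [cratio x y + d] with d > 0 is admissible, and [C] is closed. *)
Lemma cratio_cone x y : C° y -> C (cratio x y *: y - x).
Proof.
move=> Cy; apply: (@cone_cvg _ y) => d d0.
have [|s [s0 Cs]] := @inf_lt _ _ (cratio x y + d) (cratio_nonempty x Cy).
  by rewrite ltrDl.
move=> sd; rewrite addrAC -scalerDl.
rewrite -[_ + d](subrK s) scalerDl -addrA; apply: cone_add => //.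
by apply: cone_scale => //; [lra|exact: cone_int_sub].
Qed.

Lemma cratio_le x y t : C° y -> 0 <= t -> C (t *: y - x) -> cratio x y <= t.
Proof.
move=> Cy t0 Ct; apply/ler_addgt0Pr => d d0; apply: ge_inf => //.
split; first by rewrite ltr_wpDl.
rewrite /cone_le scalerDl addrAC; apply: cone_add => //.
by apply: cone_scale => //; [exact: ltW|exact: cone_int_sub].
Qed.

Lemma cratio_gt0 x y : C° y -> C x -> x != 0 -> 0 < cratio x y.
Proof.
move=> Cy Cx x0; rewrite lt_neqAle cratio_ge0// andbT eq_sym.
apply: contra_neq x0 => r0; apply: (cone_pointed properC) => //.
by have := cratio_cone x Cy; rewrite r0 scale0r add0r.
Qed.

Lemma cratioxx y : C° y -> y != 0 -> cratio y y = 1.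
Proof.
move=> Cy y0; apply/eqP; rewrite eq_le cratio_le//=; last first.
  by rewrite scale1r subrr; exact: cone_zero.
rewrite leNgt; apply/negP => lt1.
suff y0' : y = 0 by rewrite y0' eqxx in y0.
apply: (cone_pointed properC); first exact: cone_int_sub.
apply: (@cone_scaleV (1 - cratio y y)); first by lra.
have -> : (1 - cratio y y) *: - y = cratio y y *: y - y.
  by rewrite scalerBl scale1r scalerN opprK addrC.
exact: cratio_cone.
Qed.

Lemma cratio_triangle x y z : C° y -> C° z ->
  cratio x z <= cratio x y * cratio y z.
Proof.
move=> Cy Cz; apply: cratio_le => //; first by rewrite mulr_ge0 ?cratio_ge0.
have -> : (cratio x y * cratio y z) *: z - x =
    cratio x y *: (cratio y z *: z - y) + (cratio x y *: y - x).
  by rewrite scalerBr scalerA addrA subrK.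
apply: cone_add; last exact: cratio_cone.
by apply: cone_scale; [|exact: cratio_ge0|exact: cratio_cone].
Qed.

(** The order-unit estimate for [y] makes the ratio Lipschitz in [x], with constant r. *)
Lemma cratio_continuous y : C° y -> continuous (fun x => cratio x y).
Proof.
move=> Cy; have [r r0 Cr] := cone_absorb Cy.
have lip x x' : cratio x y <= cratio x' y + r * `|x - x'|.
  apply: cratio_le => //.
    by rewrite addr_ge0 ?cratio_ge0// mulr_ge0// ltW.
  have -> : (cratio x' y + r * `|x - x'|) *: y - x =
      (cratio x' y *: y - x') + ((r * `|x - x'|) *: y - (x - x')).
    by apply/rowP => i; rewrite !mxE; ring.
  by apply: cone_add => //; exact: cratio_cone.
move=> x; apply/(@cvgrPdist_le _ _ _ (nbhs x) (nbhs_filter x)) => d d0.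
have dr0 : 0 < d / r by rewrite divr_gt0.
have := @cvgr_dist_le _ _ _ (nbhs x) (nbhs_filter x) id x cvg_id _ dr0.
apply: (@filterS _ (nbhs x)) => x' /=; rewrite ler_pdivlMr// mulrC => dx.
rewrite ler_distl; have := lip x x'; have := lip x' x; rewrite (distrC x' x).
by move=> *; apply/andP; split; lra.
Qed.

Hypothesis n_gt0 : (0 < n)%N.

(** If 0 were interior, [C] would be the whole space and contain the all-ones vector and its
    opposite; that vector is nonzero as n > 0. *)
Lemma cone_int_neq0 x : C° x -> x != 0.
Proof.
move=> Cx; apply/eqP => x0; have [r r0 Cr] := cone_absorb Cx.
have Call z : C z.
  by have := Cr (- z); rewrite x0 scaler0 opprK add0r.
have := cone_pointed properC (Call (const_mx 1)) (Call _).
move=> /matrixP/(_ ord0 (Ordinal n_gt0)); rewrite !mxE => /eqP.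
by rewrite oner_eq0.
Qed.

Lemma cratio_int_gt0 x y : C° x -> C° y -> 0 < cratio x y.
Proof.
by move=> Cx Cy; apply: cratio_gt0 => //;
  [exact: cone_int_sub|exact: cone_int_neq0].
Qed.

Lemma Funk_triangle x y z : C° x -> C° y -> C° z ->
  Funk C x z <= Funk C x y + Funk C y z.
Proof.
move=> Cx Cy Cz; rewrite -lnM ?posrE ?cratio_int_gt0//.
rewrite ler_ln ?posrE ?mulr_gt0 ?cratio_int_gt0//.
exact: cratio_triangle.
Qed.

End Cone.

(** * The dynamics on the closed cone *)

(** The single condition [gauge_le] encodes both monotonicity (t = 1) and homogeneity (apply it with
    t and with its inverse). *)
Record monotone_gauge (R : realType) (n : nat) (C : set 'rV[R]_n)
    (f : 'rV[R]_n -> R) : Prop := {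
  gauge_ge0 : forall x, C x -> 0 <= f x;
  gauge_le : forall x y t, C x -> C y -> 0 < t -> C (t *: y - x) ->
    f x <= t * f y;
  gauge_continuous : {within C, continuous f} }.

Definition mShapley (R : realType) (n : nat) (A B : Type)
    (T : A -> B -> 'rV[R]_n -> 'rV[R]_n) (f : 'rV[R]_n -> R)
    (x : 'rV[R]_n) : R :=
  inf [set sup [set f (T a b x) | b in [set: B]] | a in [set: A]].

Section Dynamics.
Context (R : realType) (n : nat) (C : set 'rV[R]_n).
Context (A B : topologicalType) (T : A -> B -> 'rV[R]_n -> 'rV[R]_n).
Context (e : 'rV[R]_n).
Hypotheses (properC : proper_cone C) (gameT : conical_game C T) (Ce : C° e).
Implicit Types (x y z : 'rV[R]_n) (s t : R) (a : A) (b : B).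
Implicit Types (f g : 'rV[R]_n -> R).

Lemma dyn_cvg_right a b x s : C x -> 0 < s ->
  T a b (x + (d * s) *: e) @[d --> 0^'+] --> T a b x.
Proof.
move=> Cx s0.
have Tc := proj1 (subspace_continuousP _ _)
  (dyn_continuous_cone gameT (a := a) (b := b)) x Cx.
apply: cvg_comp Tc => P /= nP.
have xc : (x + (d * s) *: e) @[d --> 0^'+] --> x + (0 * s) *: e.
  apply: cvg_at_right_filter.
  exact: (cvgD (cvg_cst _) (cvgZr_tmp (cvgMr_tmp cvg_id))).
rewrite mul0r scale0r addr0 in xc.
have {xc} := xc _ nP; rewrite !near_simpl => xc; near=> d.
apply: (near xc d) => //; apply: cone_add => //.
apply: (cone_scale properC) (cone_int_sub Ce).
by rewrite mulr_ge0 ?(ltW s0).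
Unshelve. all: by end_near. Qed.

(** Order preservation and homogeneity are assumed on the interior only; they pass to the boundary
    by shifting both points along [e] and letting the shift tend to 0. *)
Lemma dyn_le a b x y t : C x -> C y -> 0 <= t -> C (t *: y - x) ->
  C (t *: T a b y - T a b x).
Proof.
have pos x' y' t' : C x' -> C y' -> 0 < t' -> C (t' *: y' - x') ->
    C (t' *: T a b y' - T a b x').
  move=> Cx Cy t0 Cxy.
  apply: (@closed_cvg _ _ (0^'+) _
    (fun d => t' *: T a b (y' + (d * t'^-1) *: e) - T a b (x' + (d * 1) *: e))
    C (cone_closed properC)); last first.
    have ti0 : 0 < t'^-1 by rewrite invr_gt0.
    exact: (cvgB (cvgZl_tmp (dyn_cvg_right (a := a) (b := b) Cy ti0))
                 (dyn_cvg_right (a := a) (b := b) Cx ltr01)).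
  near=> d.
  have d0 : 0 < d by [].
  have Ci u z : C z -> 0 < u -> C° (z + (d * u) *: e).
    by move=> Cz u0; apply: cone_int_add => //; apply: cone_int_scale => //;
       exact: mulr_gt0.
  have Cy' : C° (y' + (d * t'^-1) *: e) by apply: Ci; rewrite ?invr_gt0.
  rewrite -(dyn_homogeneous gameT)//.
  apply: (dyn_order_preserving gameT); [exact: Ci|exact: cone_int_scale|].
  rewrite /cone_le.
  (* The shifts d / t' and d are matched so that they cancel in this difference. *)
  have -> : t' *: (y' + (d / t') *: e) - (x' + (d * 1) *: e) = t' *: y' - x'.
    by apply/rowP => i; rewrite !mxE; field; rewrite gt_eqF.
  exact: Cxy.
rewrite le_eqVlt => Cx Cy /predU1P[<-|t0]; last exact: pos.
(* For t = 0, pointedness forces x = 0, and the case t = 1/2 at 0 puts a positive multiple of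
   [- T a b 0] in [C]. *)
rewrite !scale0r !sub0r => Cx'; have -> := cone_pointed properC Cx Cx'.
have C0 := cone_zero properC.
have /(pos _ _ _ C0 C0) : 0 < (2^-1 : R) by rewrite invr_gt0.
rewrite scaler0 subrr => /(_ C0); rewrite -{2}(scale1r (T a b 0)) -scalerBl.
have -> : 2^-1 - 1 = 2^-1 * -1 :> R by lra.
by rewrite -scalerA scaleN1r => /cone_scaleV; apply => //; rewrite invr_gt0.
Unshelve. all: by end_near. Qed.

(** The images of [e] form a compact subset of the interior. Near each of them both relations hold
    for all small s > 0, and compactness makes s uniform: c = s, D = s^-1. *)
Lemma dyn_bounds : exists c D : R, [/\ 0 < c, 0 < D &
  forall a b, C (T a b e - c *: e) /\ C (D *: e - T a b e)].
Proof.
have /compact_near_coveringP cov : compact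
    [set y | exists a b x, [set e] x /\ y = T a b x].
  by apply: (dyn_compact gameT); [exact: compact_set1|move=> x ->].
have : \forall s \near (0 : R)^'+,
    [set y | exists a b x, [set e] x /\ y = T a b x] `<=`
    [set y | C (y - s *: e) /\ C (e - s *: y)].
  apply: (cov _ (0 : R)^'+) => _ [a [b [_ [-> ->]]]].
  have Ci : C° (T a b e) by exact: (dyn_interior gameT).
  set y := T a b e in Ci *.
  have c2 : (fun p : 'rV[R]_n * R => p.2) @ (filter_prod (nbhs y) (0 : R)^'+)
      --> (0 : R).
    by apply: cvg_trans cvg_snd _; exact: cvg_within.
  have c1 : (fun p : 'rV[R]_n * R => p.1 - p.2 *: e)
      @ (filter_prod (nbhs y) (0 : R)^'+) --> y - 0 *: e.
    exact: (cvgB cvg_fst (cvgZr_tmp c2)).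
  have c3 : (fun p : 'rV[R]_n * R => e - p.2 *: p.1)
      @ (filter_prod (nbhs y) (0 : R)^'+) --> e - 0 *: y.
    exact: (cvgB (cvg_cst _) (cvgZ c2 cvg_fst)).
  rewrite scale0r subr0 in c1; rewrite scale0r subr0 in c3.
  have n1 : filter_prod (nbhs y) (0 : R)^'+ (fun p => C (p.1 - p.2 *: e)).
    exact: c1 C Ci.
  have n3 : filter_prod (nbhs y) (0 : R)^'+ (fun p => C (e - p.2 *: p.1)).
    exact: c3 C Ce.
  exact: filterI n1 n3.
move=> nK; near (0 : R)^'+ => s.
have s0 : 0 < s by [].
have H a b : C (T a b e - s *: e) /\ C (e - s *: T a b e).
  by apply: (near nK s) => //; exists a, b, e.
exists s, s^-1; split => //; first by rewrite invr_gt0.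
move=> a b; have [H1 H2] := H a b; split => //.
have /(cone_scale properC) : 0 <= s^-1 by rewrite invr_ge0 ltW.
by move=> /(_ _ H2); rewrite scalerBr scalerA mulVf ?scale1r ?gt_eqF.
Unshelve. all: by end_near. Qed.

Lemma gauge_le0 f : monotone_gauge C f -> f 0 <= 0.
Proof.
move=> gf; have C0 := cone_zero properC.
have /(gauge_le gf C0 C0) : 0 < (2^-1 : R) by rewrite invr_gt0.
rewrite scaler0 subrr => /(_ C0); lra.
Qed.

Lemma gauge_leW f x y t : monotone_gauge C f -> C x -> C y -> 0 <= t ->
  C (t *: y - x) -> f x <= t * f y.
Proof.
move=> gf Cx Cy; rewrite le_eqVlt => /predU1P[<-|]; last exact: gauge_le.
rewrite scale0r sub0r mul0r => Cx'.
by rewrite (cone_pointed properC Cx Cx'); exact: gauge_le0.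
Qed.

(** From x <= M(x) e and T_ab e <= D e, every T_ab x lies below M(x) D e, whatever the actions. *)
Lemma gauge_bounded f x : monotone_gauge C f -> C x ->
  exists m, forall a b, f (T a b x) <= m.
Proof.
move=> gf Cx; have [c [D [_ D0 H]]] := dyn_bounds.
exists (cratio C x e * D * f e) => a b.
have Cx' := cone_int_sub Ce.
have Mx := cratio_ge0 properC x Ce.
apply: gauge_leW; rewrite ?mulr_ge0// ?(ltW D0)//.
  exact: (dyn_cone gameT).
have := dyn_le a b Cx Cx' Mx (cratio_cone properC x Ce).
have [_ /(cone_scale properC Mx) H2] := H a b.
move=> /(cone_add properC H2); congr C.
by apply/rowP => i; rewrite !mxE; ring.
Qed.

End Dynamics.

(** * The multiplicative Shapley operator on gauges *)

Section ShapleyOperator.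
Context (R : realType) (n : nat) (C : set 'rV[R]_n).
Context (A B : topologicalType) (T : A -> B -> 'rV[R]_n -> 'rV[R]_n).
Context (e : 'rV[R]_n).
Hypotheses (properC : proper_cone C) (gameT : conical_game C T) (Ce : C° e).
Implicit Types (x y z : 'rV[R]_n) (s t : R) (a : A) (b : B).
Implicit Types (f g : 'rV[R]_n -> R).

Let sups_nonempty f x a : [set f (T a b x) | b in [set: B]] !=set0.
Proof.
by have [b _] := max_actions_nonempty gameT; exists (f (T a b x)), b.
Qed.

Let le_sups f x a b : monotone_gauge C f -> C x ->
  f (T a b x) <= sup [set f (T a b x) | b in [set: B]].
Proof.
move=> gf Cx; apply: ub_le_sup; last by exists b.
have [m H] := gauge_bounded properC gameT Ce gf Cx.
by exists m => _ [b' _ <-].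
Qed.

Let inf_lb f x : monotone_gauge C f -> C x ->
  has_lbound [set sup [set f (T a b x) | b in [set: B]] | a in [set: A]].
Proof.
move=> gf Cx; exists 0 => _ [a _ <-].
have [b _] := max_actions_nonempty gameT.
apply: le_trans (le_sups a b gf Cx); apply: (gauge_ge0 gf).
exact: (dyn_cone gameT).
Qed.

Let inf_nonempty f x :
  [set sup [set f (T a b x) | b in [set: B]] | a in [set: A]] !=set0.
Proof.
by have [a _] := min_actions_nonempty gameT; eexists; exists a.
Qed.

Lemma mShapley_le f x a t : monotone_gauge C f -> C x ->
  (forall b, f (T a b x) <= t) -> mShapley T f x <= t.
Proof.
move=> gf Cx ft; apply: (@le_trans _ _ (sup [set f (T a b x) | b in [set: B]])).
  by apply: ge_inf; [exact: inf_lb|exists a].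
by apply: ge_sup => // _ [b _ <-].
Qed.

Lemma mShapley_ge f x t : monotone_gauge C f -> C x ->
  (forall a, exists b, t <= f (T a b x)) -> t <= mShapley T f x.
Proof.
move=> gf Cx ft; apply: lb_le_inf => // _ [a _ <-].
by have [b /le_trans] := ft a; apply; exact: le_sups.
Qed.

Lemma mShapley_lt f x t : monotone_gauge C f -> C x -> mShapley T f x < t ->
  exists a, forall b, f (T a b x) < t.
Proof.
move=> gf Cx /(inf_lt (inf_nonempty f x))[_ [a _ <-]] lt; exists a => b.
by apply: le_lt_trans lt; exact: le_sups.
Qed.

(** Min plays at [x] an action nearly optimal for [g] at [y]. The factor t serves monotonicity and
    homogeneity, the shift s continuity. *)
Lemma mShapley_compare f g x y t s : monotone_gauge C f -> monotone_gauge C g ->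
  C x -> C y -> 0 < t -> (forall a b, f (T a b x) <= t * g (T a b y) + s) ->
  mShapley T f x <= t * mShapley T g y + s.
Proof.
move=> gf gg Cx Cy t0 fg; apply/ler_addgt0Pr => d d0.
have [|a ga] := @mShapley_lt g y (mShapley T g y + d / t) gg Cy.
  by rewrite ltrDl divr_gt0.
apply: (mShapley_le (a := a)) => // b; apply: le_trans (fg a b) _.
rewrite addrAC lerD2r; apply: le_trans (_ : t * (mShapley T g y + d / t) <= _).
  by rewrite ler_pM2l// ltW.
by rewrite mulrDr mulrCA divff ?mulr1// gt_eqF.
Qed.

(** Near each pair (a, b), joint continuity keeps the values at [x] and at [y] within d / 2 of f
    (T_ab x); compactness of the action sets makes one neighbourhood of [x] serve all pairs. *)
Lemma gauge_dyn_uniform f x d : monotone_gauge C f -> C x -> 0 < d ->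
  \forall y \near within C (nbhs x),
    forall a b, `|f (T a b x) - f (T a b y)| <= d.
Proof.
move=> gf Cx d0.
have : compact [set: A * B].
  rewrite -setXTT; apply: compact_setX.
    exact: min_actions_compact gameT.
  exact: max_actions_compact gameT.
move=> /compact_near_coveringP cov.
suff : \forall y \near within C (nbhs x), [set: A * B] `<=`
    [set p | `|f (T p.1 p.2 x) - f (T p.1 p.2 y)| <= d].
  by apply: filterS => y sub a b; exact: (sub (a, b)).
apply: (cov _ (within C (nbhs x))) => -[a b] _ /=.
have d20 : 0 < d / 2 by rewrite divr_gt0.
pose F (p : A * B * 'rV[R]_n) := f (T p.1.1 p.1.2 p.2).
have Fc : F @ within [set p : A * B * 'rV[R]_n | C p.2] (nbhs (a, b, x))
    --> f (T a b x).
  have Tc := proj1 (subspace_continuousP _ _)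
    (dyn_continuous_joint gameT) (a, b, x) Cx.
  have fc := proj1 (subspace_continuousP _ _) (gauge_continuous gf)
    (T a b x) (dyn_cone gameT a b Cx).
  apply: cvg_comp fc => P nP.
  have := Tc _ nP; rewrite /= !near_simpl /within /=.
  apply: (@filterS _ (nbhs (a, b, x))) => p H Cp; apply: H => //.
  by apply: (dyn_cone gameT).
have Fd : \forall p \near nbhs (a, b) & y \near nbhs x,
    C y -> `|f (T a b x) - f (T p.1 p.2 y)| <= d / 2.
  exact: (@cvgr_dist_le _ _ _ _ (within_filter _ _) F _ Fc _ d20).
have Fx : \forall p \near nbhs (a, b),
    `|f (T a b x) - f (T p.1 p.2 x)| <= d / 2.
  case: Fd => -[U V] /= [nU nV] UV.
  apply: filterS nU => p Up; apply: (UV (p, x)) => //; split => //.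
  exact: nbhs_singleton.
case: Fd => -[U V] /= [nU nV] UV.
exists (U `&` [set p | `|f (T a b x) - f (T p.1 p.2 x)| <= d / 2], V `&` C).
  split; first exact: filterI.
  by apply: filterS nV.
move=> [p y] /= [[Up px] [Vy Cy]]; have /= := UV (p, y) (conj Up Vy) Cy.
move: px; rewrite !ler_norml => /andP[? ?] /andP[? ?].
by apply/andP; split; lra.
Qed.

Lemma mShapley_gauge f : monotone_gauge C f -> monotone_gauge C (mShapley T f).
Proof.
move=> gf; split=> [x Cx|x y t Cx Cy t0 Cxy|].
- apply: mShapley_ge => // a; have [b _] := max_actions_nonempty gameT.
  by exists b; apply: (gauge_ge0 gf); exact: (dyn_cone gameT).
- rewrite -[leRHS]addr0; apply: mShapley_compare => // a b; rewrite addr0.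
  apply: (gauge_le gf) => //; [exact: (dyn_cone gameT)..|].
  by apply: (dyn_le properC gameT Ce) => //; exact: ltW.
- apply/subspace_continuousP => x Cx.
  apply/(@cvgrPdist_le _ _ _ (within C (nbhs x)) (within_filter _ _)) => d d0.
  have /= := gauge_dyn_uniform gf Cx d0.
  rewrite /within /=; apply: (@filterS _ (nbhs x)) => y H Cy.
  have {}H a b :
      f (T a b x) <= f (T a b y) + d /\ f (T a b y) <= f (T a b x) + d.
    by have := H Cy a b; rewrite ler_norml => /andP[? ?]; split; lra.
  have := @mShapley_compare f f x y 1 d gf gf Cx Cy ltr01.
  have := @mShapley_compare f f y x 1 d gf gf Cy Cx ltr01.
  rewrite !mul1r => H1 H2; rewrite ler_norml; apply/andP; split.
    suff : mShapley T f y <= mShapley T f x + d by lra.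
    by apply: H1 => a b; rewrite mul1r; have [] := H a b.
  suff : mShapley T f x <= mShapley T f y + d by lra.
  by apply: H2 => a b; rewrite mul1r; have [] := H a b.
Qed.

End ShapleyOperator.

(** * Finite horizon values and supersolutions *)

Section Gauges.
Context (R : realType) (n : nat) (C : set 'rV[R]_n) (e : 'rV[R]_n).
Hypotheses (properC : proper_cone C) (Ce : C° e).
Implicit Types (x y z : 'rV[R]_n) (s t : R) (f g : 'rV[R]_n -> R).

Lemma gauge_cratio : monotone_gauge C (cratio C ^~ e).
Proof.
split=> [x Cx|x y t Cx Cy t0 Cxy|]; first exact: cratio_ge0.
- apply: cratio_le => //.
    by rewrite mulr_ge0 ?(ltW t0)//; exact: cratio_ge0.
  have /(cone_scale properC (ltW t0)) := cratio_cone properC y Ce.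
  move=> /(cone_add properC Cxy); congr C.
  by apply/rowP => i; rewrite !mxE; ring.
- by apply: continuous_subspaceT; exact: cratio_continuous.
Qed.

Lemma gauge_add f g : monotone_gauge C f -> monotone_gauge C g ->
  monotone_gauge C (fun x => f x + g x).
Proof.
move=> gf gg; split=> [x Cx|x y t Cx Cy t0 Cxy|].
- by rewrite addr_ge0 ?(gauge_ge0 gf) ?(gauge_ge0 gg).
- by rewrite mulrDr lerD ?(gauge_le gf) ?(gauge_le gg).
- exact: (within_continuousD (gauge_continuous gf) (gauge_continuous gg)).
Qed.

Lemma gauge_scale f s : 0 <= s -> monotone_gauge C f ->
  monotone_gauge C (fun x => s * f x).
Proof.
move=> s0 gf; split=> [x Cx|x y t Cx Cy t0 Cxy|].
- by rewrite mulr_ge0 ?(gauge_ge0 gf).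
- by rewrite mulrCA ler_wpM2l ?(gauge_le gf).
- move=> x; exact: (cvgMl_tmp (gauge_continuous gf (x := x))).
Qed.

Lemma gauge_min f g : monotone_gauge C f -> monotone_gauge C g ->
  monotone_gauge C (fun x => Num.min (f x) (g x)).
Proof.
move=> gf gg; split=> [x Cx|x y t Cx Cy t0 Cxy|].
- by rewrite le_min (gauge_ge0 gf) ?(gauge_ge0 gg).
- rewrite minr_pMr ?(ltW t0)// le_min !ge_min.
  by rewrite (gauge_le gf Cx Cy t0 Cxy) (gauge_le gg Cx Cy t0 Cxy) orbT.
- by move=> x; apply: continuous_min;
    [exact: (gauge_continuous gf)|exact: (gauge_continuous gg)].
Qed.

Lemma gauge_bigmin (I : Type) (r : seq I) f (F : I -> 'rV[R]_n -> R) :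
  monotone_gauge C f -> (forall i, monotone_gauge C (F i)) ->
  monotone_gauge C (fun x => \big[Num.min/f x]_(i <- r) F i x).
Proof.
move=> gf gF; elim: r => [|i r IH].
  by under [X in monotone_gauge C X]eq_fun do rewrite big_nil.
under [X in monotone_gauge C X]eq_fun do rewrite big_cons.
exact: gauge_min.
Qed.

Lemma gauge_le_cratio f x : monotone_gauge C f -> C x ->
  f x <= cratio C x e * f e.
Proof.
move=> gf Cx; apply: (gauge_leW properC gf) => //; first exact: cone_int_sub.
  exact: cratio_ge0.
exact: cratio_cone.
Qed.

End Gauges.

Section Iterates.
Context (R : realType) (n : nat) (C : set 'rV[R]_n).
Context (A B : topologicalType) (T : A -> B -> 'rV[R]_n -> 'rV[R]_n).
Context (e : 'rV[R]_n).
Hypotheses (properC : proper_cone C) (gameT : conical_game C T) (Ce : C° e).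
Hypothesis n_gt0 : (0 < n)%N.
Implicit Types (x y z : 'rV[R]_n) (s t : R) (a : A) (b : B).
Implicit Types (f g : 'rV[R]_n -> R) (k : nat) (lam eps : R).

Let cratioee : cratio C e e = 1.
Proof. by apply: cratioxx => //; exact: (cone_int_neq0 properC n_gt0 Ce). Qed.

Definition finite_value k : 'rV[R]_n -> R :=
  iter k (mShapley T) (cratio C ^~ e).

Lemma gauge_finite_value k : monotone_gauge C (finite_value k).
Proof.
elim: k => [|k IH]; first exact: gauge_cratio.
by apply: (mShapley_gauge properC gameT Ce).
Qed.

(** Every T_ab e dominates c e, so each stage loses at most a factor c. This keeps the infimum in
    [escape_rate] finite. *)
Lemma finite_value_ge : exists2 c : R, 0 < c &
  forall k, c ^+ k <= finite_value k e.
Proof.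
have [c [D [c0 _ H]]] := dyn_bounds properC gameT Ce.
exists c => //; elim=> [|k IH].
  by rewrite [leRHS]cratioee.
have Ce' := cone_int_sub Ce.
rewrite exprS; apply: (@le_trans _ _ (c * finite_value k e)).
  by rewrite ler_pM2l.
apply: (mShapley_ge properC gameT Ce (gauge_finite_value k)) => // a.
have [b _] := max_actions_nonempty gameT; exists b.
rewrite -ler_pdivlMl//; apply: (gauge_le (gauge_finite_value k)) => //.
- exact: (dyn_cone gameT).
- by rewrite invr_gt0.
- have [/(cone_scale properC (t := c^-1)) + _] := H a b.
  rewrite scalerBr scalerA mulVf ?gt_eqF// scale1r; apply.
  by rewrite invr_ge0 ltW.
Qed.

Definition escape_rate : R :=
  inf [set ln (finite_value k.+1 e) / k.+1%:R | k in [set: nat]].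

Let finite_value_gt0 k : 0 < finite_value k e.
Proof.
by have [c c0 /(_ k)] := finite_value_ge; apply: lt_le_trans; rewrite exprn_gt0.
Qed.

Lemma escape_rate_le k : expR (escape_rate * k%:R) <= finite_value k e.
Proof.
case: k => [|k].
  by rewrite mulr0 expR0 [leRHS]cratioee.
rewrite -[leRHS]lnK ?posrE// ler_expR -ler_pdivlMr//.
apply: ge_inf; last by exists k.
have [c c0 H] := finite_value_ge.
exists (ln c) => _ [j _ <-]; rewrite ler_pdivlMr// mulr_natr -lnXn//.
by rewrite ler_ln ?posrE// ?exprn_gt0.
Qed.

Lemma escape_rate_lt lam : escape_rate < lam ->
  exists k, finite_value k.+1 e < expR (lam * k.+1%:R).
Proof.
move=> /inf_lt[|_ [k _ <-]]; first by eexists; exists 0.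
rewrite ltr_pdivrMr// => lt; exists k.
by rewrite -[ltLHS]lnK ?posrE// ltr_expR.
Qed.

Fixpoint perturbed_value eps k : 'rV[R]_n -> R :=
  if k is j.+1 then
    fun x => mShapley T (perturbed_value eps j) x + eps * cratio C x e
  else cratio C ^~ e.

Lemma gauge_perturbed_value eps k : 0 <= eps ->
  monotone_gauge C (perturbed_value eps k).
Proof.
move=> e0; elim: k => [|k IH]; first exact: gauge_cratio.
apply: gauge_add; first exact: (mShapley_gauge properC gameT Ce).
by apply: gauge_scale => //; exact: gauge_cratio.
Qed.

(** The perturbation costs a term linear in eps. In the recursion K D + 1, the factor D bounds the
    growth of M in one turn and 1 counts the new term eps M. *)
Lemma perturbed_value_le k : exists2 K : R, 0 <= K & forall eps x, 0 <= eps ->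
  C x -> perturbed_value eps k x <= finite_value k x + eps * K * cratio C x e.
Proof.
have [c [D [_ D0 H]]] := dyn_bounds properC gameT Ce.
have Ce' := cone_int_sub Ce.
have MT a b x : C x -> cratio C (T a b x) e <= D * cratio C x e.
  move=> Cx; rewrite mulrC; have Mx := cratio_ge0 properC x Ce.
  apply: cratio_le => //; first by rewrite mulr_ge0 ?(ltW D0).
  have := dyn_le properC gameT Ce a b Cx Ce' Mx (cratio_cone properC x Ce).
  have [_ /(cone_scale properC Mx) H2] := H a b.
  move=> /(cone_add properC H2); congr C.
  by apply/rowP => i; rewrite !mxE ; ring.
elim: k => [|k [K K0 IH]].
  by exists 0 => // eps x _ _; rewrite mulr0 mul0r addr0.
exists (K * D + 1); first by rewrite addr_ge0 ?mulr_ge0 ?(ltW D0).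
move=> eps x eps0 Cx /=.
rewrite mulrDr mulrDl mulr1 addrA lerD2r.
rewrite -[X in _ <= X + _]mul1r.
apply: (mShapley_compare properC gameT Ce) => //.
- exact: gauge_perturbed_value.
- exact: gauge_finite_value.
move=> a b; rewrite mul1r; apply: le_trans (IH _ _ eps0 _) _.
  exact: (dyn_cone gameT).
rewrite lerD2l -!mulrA ler_wpM2l// ler_wpM2l//; exact: MT.
Qed.

(* The term [eps * cratio C x e] of [perturbed_value] keeps the minimum of the
   rescaled iterates from vanishing on the boundary of the cone. *)
Lemma supersolution lam : escape_rate < lam ->
  exists w c, [/\ monotone_gauge C w, 0 < c,
    forall x, C x -> c * cratio C x e <= w x &
    forall x, C x -> mShapley T w x <= expR lam * w x].
Proof.
move=> /escape_rate_lt[N ltN].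
have [K K0 HK] := perturbed_value_le N.+1.
pose d := expR (lam * N.+1%:R) - finite_value N.+1 e.
have d0 : 0 < d by rewrite subr_gt0.
(* With this choice eps K <= d, so the perturbed value at [e] does not exceed expR (lam * N.+1). *)
pose eps := d / (K + 1).
have K1 : 0 < K + 1 by rewrite ltr_wpDl.
have eps0 : 0 < eps by rewrite divr_gt0.
have Ce' := cone_int_sub Ce.
have M0 x : 0 <= cratio C x e by exact: cratio_ge0.
pose g := perturbed_value eps.
have gg k : monotone_gauge C (g k) by apply: gauge_perturbed_value; exact: ltW.
have gN x : C x -> g N.+1 x <= expR (lam * N.+1%:R) * cratio C x e.
  move=> Cx; apply: le_trans (gauge_le_cratio properC Ce (gg _) Cx) _.
  rewrite mulrC ler_wpM2r ?M0//; apply: le_trans (HK _ _ (ltW eps0) Ce') _.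
  rewrite cratioee mulr1 -lerBrDl -/d /eps mulrAC ler_pdivrMr//.
  by rewrite ler_pM2l// lerDl.
pose F (k : 'I_N.+1) x := expR (- (lam * k%:R)) * g k x.
(* The default value of the minimum equals its term of index 0, since g_0 = M. *)
pose w x := \big[Num.min/cratio C x e]_(i < N.+1) F i x.
have gF (i : 'I_N.+1) : monotone_gauge C (F i).
  by apply: gauge_scale => //; exact: expR_ge0.
have gw : monotone_gauge C w by apply: gauge_bigmin => //; exact: gauge_cratio.
have wF (i : 'I_N.+1) x : w x <= F i x by exact: bigmin_le.
(* The factor min(1, eps) reflects g_0 = M and, for k > 0, g_k >= eps M. *)
pose c := \big[Num.min/1]_(k < N.+1) (expR (- (lam * k%:R)) * Num.min 1 eps).
exists w, c; split => //.
- rewrite /c; elim/big_ind : _ => // [x y x0 y0|k _].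
    by rewrite lt_min x0.
  by rewrite mulr_gt0 ?expR_gt0// lt_min ltr01.
- move=> x Cx; apply/bigmin_geP; split.
    by rewrite -[leRHS]mul1r ler_wpM2r// bigmin_le_id.
  move=> k _; apply: (@le_trans _ _
      (expR (- (lam * k%:R)) * Num.min 1 eps * cratio C x e)).
    by rewrite ler_wpM2r// /c; apply: bigmin_le.
  rewrite -mulrA ler_pM2l ?expR_gt0//.
  case: k => -[|k] /= _.
    by rewrite -[leRHS]mul1r ler_wpM2r// ge_min lexx.
  apply: (@le_trans _ _ (eps * cratio C x e)).
    by rewrite ler_wpM2r// ge_min lexx orbT.
  by rewrite lerDr (gauge_ge0 (mShapley_gauge properC gameT Ce (gg k))).
move=> x Cx; rewrite -ler_pdivrMl ?expR_gt0// -expRN.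
(* Applying F to w <= exp(-lam k) g_k and using F g_k <= g_{k+1} advances the index by one. *)
have step (k : 'I_N.+1) :
    expR (- lam) * mShapley T w x <= expR (- (lam * k.+1%:R)) * g k.+1 x.
  have -> : - (lam * k.+1%:R) = - lam - lam * k%:R.
    by rewrite -natr1; ring.
  rewrite expRD -mulrA ler_pM2l ?expR_gt0//.
  apply: (@le_trans _ _ (expR (- (lam * k%:R)) * mShapley T (g k) x + 0)).
    apply: (mShapley_compare properC gameT Ce) => //; first exact: expR_gt0.
    by move=> a b; rewrite addr0; exact: wF.
  by rewrite addr0 ler_pM2l ?expR_gt0//= lerDl mulr_ge0// ltW.
(* The last index closes the cycle: exp(-lam (N+1)) g_{N+1} <= M = g_0. *)
have stepM : expR (- lam) * mShapley T w x <= cratio C x e.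
  apply: le_trans (step ord_max) _.
  by rewrite expRN ler_pdivrMl ?expR_gt0//; exact: gN.
apply/bigmin_geP; split => // -[[|k] kN] _; rewrite /F /=.
  by rewrite mulr0 oppr0 expR0 mul1r.
exact: (step (Ordinal (ltnW kN))).
Qed.

End Iterates.

(** * Strategies *)

Section Limsup.
Context (R : realType) (u : nat -> R) (lam K : R).


Lemma limn_esup_ratio_le : (forall k, u k <= lam * k%:R + K) ->
  (limn_esup (fun k => (u k / k%:R)%:E) <= lam%:E)%E.
Proof.
move=> uK; apply/lee_addgt0Pr => d d0.
(* From this index on |K| <= d k, and the successor excludes k = 0. *)
pose N := (Num.truncn (`|K| / d)).+1.
apply: (@le_trans _ _
    (ereal_sup [set (u k / k%:R)%:E | k in [set k | (N <= k)%N]])).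
  by apply: ereal_inf_lbound; exists [set k | (N <= k)%N] => //; exists N.
apply: ge_ereal_sup => _ [k /= Nk <-].
have k0 : 0 < k%:R :> R by rewrite ltr0n (leq_trans _ Nk).
rewrite -EFinD lee_fin ler_pdivrMr// mulrDl; apply: le_trans (uK k) _.
rewrite lerD2l; apply: le_trans (ler_norm _) _.
rewrite mulrC -ler_pdivrMr//; apply: ltW.
by apply: lt_le_trans (truncnS_gt _) _; rewrite ler_nat.
Qed.

Lemma limn_esup_ratio_ge : (forall k, lam * k%:R + K <= u k) ->
  (lam%:E <= limn_esup (fun k => (u k / k%:R)%:E))%E.
Proof.
move=> uK; apply/lee_subgt0Pr => d d0.
apply: le_ereal_inf_tmp => _ [V [m _ mV] <-].
pose k := maxn m (Num.truncn (`|K| / d)).+1.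
apply: (@le_trans _ _ (u k / k%:R)%:E); last first.
  by apply: ereal_sup_ubound; exists k => //; apply: mV; rewrite /= leq_maxl.
have Nk : ((Num.truncn (`|K| / d)).+1 <= k)%N by exact: leq_maxr.
have k0 : 0 < k%:R :> R by rewrite ltr0n (leq_trans _ Nk).
rewrite lee_fin ler_pdivlMr// mulrBl; apply: le_trans (uK k).
rewrite lerD2l lerNl; apply: le_trans (ler_norm _) _; rewrite normrN.
rewrite mulrC -ler_pdivrMr//; apply: ltW.
by apply: lt_le_trans (truncnS_gt _) _; rewrite ler_nat.
Qed.

End Limsup.

Section Strategies.
Context (R : realType) (n : nat) (C : set 'rV[R]_n).
Context (A B : topologicalType) (T : A -> B -> 'rV[R]_n -> 'rV[R]_n).
Hypotheses (properC : proper_cone C) (gameT : conical_game C T).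
Hypothesis n_gt0 : (0 < n)%N.
Context (x0 x1 : 'rV[R]_n) (alpha lam : R) (v : 'rV[R]_n -> R).
Hypotheses (Cx0 : C° x0) (Cx1 : C° x1).

Lemma play_stateS (sigma : min_strategy R n A B)
    (tau : max_strategy R n A B) k :
  let h := iter k (next_history T sigma tau) (x0, [::]) in
  play_state T x0 sigma tau k.+1 =
    T (sigma h) (tau h (sigma h)) (play_state T x0 sigma tau k).
Proof. by rewrite /play_state /= /current_state /= map_rcons last_rcons. Qed.

Lemma play_state_interior (sigma : min_strategy R n A B)
    (tau : max_strategy R n A B) k : C° (play_state T x0 sigma tau k).
Proof.
by elim: k => // k IH; rewrite play_stateS; apply: (dyn_interior gameT).
Qed.

(** Under the positional strategy [s], v grows by at most lam per turn, and v bounds Funk(., x1) up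
    to a constant; the triangle inequality replaces x1 by x0 at a bounded cost. *)
Lemma min_guarantee :
  (forall x, C° x -> alpha + Funk C x x1 <= v x) ->
  (forall x, C° x -> exists a, forall b, v (T a b x) <= lam + v x) ->
  (upper_value C T x0 <= lam%:E)%E.
Proof.
move=> vlb vstep; have [a0 _] := min_actions_nonempty gameT.
have /choice[s Hs] : forall x, exists a,
    C° x -> forall b, v (T a b x) <= lam + v x.
  move=> x; have [Cx|nCx] := pselect (C° x); last by exists a0.
  by have [a Ha] := vstep x Cx; exists a.
pose sigma : min_strategy R n A B := fun h => s (current_state h).
apply: (@le_trans _ _ (ereal_sup [set payoff C T x0 sigma tau
    | tau in [set: max_strategy R n A B]])).
  by apply: ereal_inf_lbound; exists sigma.
apply: ge_ereal_sup => _ [tau _ <-].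
apply: (@limn_esup_ratio_le _ _ _ (v x0 - alpha + Funk C x1 x0)) => k.
have Ck := play_state_interior sigma tau k.
have vk : v (play_state T x0 sigma tau k) <= lam * k%:R + v x0.
  elim: k {Ck} => [|k IH]; first by rewrite mulr0 add0r.
  rewrite play_stateS; apply: le_trans (Hs _ _ _) _.
    exact: play_state_interior.
  by rewrite -natr1 mulrDr mulr1; lra.
have := vlb _ Ck; have := Funk_triangle properC n_gt0 Ck Cx1 Cx0.
lra.
Qed.

(** Mirror argument: v grows by at least lam per turn under Max's positional replies, and Funk(x_k,
    x1) is bounded through Funk(x_k, x0). *)
Lemma max_guarantee :
  (forall x, C° x -> v x <= alpha + Funk C x x1) ->
  (forall x a, C° x -> exists b, lam + v x <= v (T a b x)) ->
  (lam%:E <= lower_value C T x0)%E.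
Proof.
move=> vub vstep; have [b0 _] := max_actions_nonempty gameT.
have /choice[s Hs] : forall p : 'rV[R]_n * A, exists b,
    C° p.1 -> lam + v p.1 <= v (T p.2 b p.1).
  move=> [x a] /=; have [Cx|nCx] := pselect (C° x); last by exists b0.
  by have [b Hb] := vstep x a Cx; exists b.
pose tau : max_strategy R n A B := fun h a => s (current_state h, a).
apply: (@le_trans _ _ (ereal_inf [set payoff C T x0 sigma tau
    | sigma in [set: min_strategy R n A B]])); last first.
  by apply: ereal_sup_ubound; exists tau.
apply: le_ereal_inf_tmp => _ [sigma _ <-].
apply: (@limn_esup_ratio_ge _ _ _ (v x0 - alpha - Funk C x0 x1)) => k.
have Ck := play_state_interior sigma tau k.
have vk : lam * k%:R + v x0 <= v (play_state T x0 sigma tau k).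
  elim: k {Ck} => [|k IH]; first by rewrite mulr0 add0r.
  rewrite play_stateS; apply: le_trans (Hs (_, _) _); last first.
    exact: play_state_interior.
  by rewrite -natr1 mulrDr mulr1 /=; rewrite /play_state in IH; lra.
have := vub _ Ck; have := Funk_triangle properC n_gt0 Ck Cx0 Cx1.
lra.
Qed.

Lemma lower_value_le_upper : (lower_value C T x0 <= upper_value C T x0)%E.
Proof.
apply: ge_ereal_sup => _ [tau _ <-]; apply: le_ereal_inf_tmp => _ [sigma _ <-].
apply: (@le_trans _ _ (payoff C T x0 sigma tau)).
  by apply: ereal_inf_lbound; exists sigma.
by apply: ereal_sup_ubound; exists tau.
Qed.

End Strategies.

(** * A subsolution for Max *)

Section Subsolution.
Context (R : realType) (n : nat) (C : set 'rV[R]_n).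
Context (A B : topologicalType) (T : A -> B -> 'rV[R]_n -> 'rV[R]_n).
Context (e : 'rV[R]_n).
Hypotheses (properC : proper_cone C) (gameT : conical_game C T) (Ce : C° e).
Hypothesis n_gt0 : (0 < n)%N.
Implicit Types (x y z : 'rV[R]_n) (s t c : R) (a : A) (b : B).
Context (lam : R).
Hypothesis lam_lt : lam < escape_rate C T e.

Let f := finite_value C T e.
Let gf k : monotone_gauge C (f k).
Proof. exact: gauge_finite_value. Qed.

Let Ce' := cone_int_sub Ce.

(** The functions G_N; the default 0 is harmless on [C], where all terms are nonnegative. *)
Definition discounted_max (N : nat) x : R :=
  \big[Num.max/0]_(k < N.+1) (expR (- (lam * k%:R)) * finite_value C T e k x).

Let G := discounted_max.

Let term_le N k x : (k <= N)%N -> expR (- (lam * k%:R)) * f k x <= G N x.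
Proof.
by move=> kN; apply: (@le_bigmax _ _ _ _
  (fun i : 'I_N.+1 => expR (- (lam * i%:R)) * f i x)
  (Ordinal (kN : (k < N.+1)%N))).
Qed.

Let G_le N x y t : C x -> C y -> 0 < t -> C (t *: y - x) -> G N x <= t * G N y.
Proof.
move=> Cx Cy t0 Cxy; apply/bigmax_leP; split.
  by rewrite mulr_ge0 ?(ltW t0)//; exact: bigmax_ge_id.
move=> [k kN] _; apply: (@le_trans _ _ (t * (expR (- (lam * k%:R)) * f k y))).
  by rewrite mulrCA ler_pM2l ?expR_gt0//; exact: (gauge_le (gf k)).
by rewrite ler_pM2l//; exact: term_le.
Qed.

Let G_unbounded c : \forall N \near \oo, c <= G N e.
Proof.
pose d := escape_rate C T e - lam; have d0 : 0 < d by rewrite subr_gt0.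
exists (Num.truncn (`|c| / d)).+1 => // N /= ltN.
apply: le_trans (term_le e (leqnn N)).
(* The term k = N alone is at least exp(d N) >= 1 + d N, with d the gap between the escape rate and
   lam. *)
apply: (@le_trans _ _ (expR (d * N%:R))); last first.
  rewrite mulrBl expRD mulrC ler_pM2l ?expR_gt0//.
  exact: escape_rate_le.
apply: le_trans (expR_ge1Dx _); rewrite -[c]add0r lerD//.
apply: le_trans (ler_norm _) _; rewrite mulrC -ler_pdivrMr//; apply: ltW.
by apply: lt_le_trans (truncnS_gt _) _; rewrite ler_nat.
Qed.

(** The limsup of G_N x / G_N e, written as the infimum of the eventual bounds so that no quotient
    appears. *)
Definition limit_gauge x : R :=
  inf [set c | 0 <= c /\
    \forall N \near \oo, discounted_max N x <= c * discounted_max N e].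

Let h := limit_gauge.

Let h_le x c : 0 <= c -> (\forall N \near \oo, G N x <= c * G N e) -> h x <= c.
Proof. by move=> c0 Hc; apply: ge_inf => //; exists 0 => d []. Qed.

Let h_set x : C° x ->
  [set c | 0 <= c /\ \forall N \near \oo, G N x <= c * G N e] (cratio C x e).
Proof.
move=> Cx; split; first exact: cratio_ge0.
near=> N; apply: G_le => //; [exact: cone_int_sub|exact: cratio_int_gt0|].
exact: cratio_cone.
Unshelve. all: by end_near. Qed.

Let h_lt x c : C° x -> h x < c -> \forall N \near \oo, G N x <= c * G N e.
Proof.
move=> Cx /inf_lt[|d [d0 Hd] dc]; first by eexists; exact: h_set.
apply: filterS Hd => N /le_trans; apply.
by rewrite ler_wpM2r ?(ltW dc)//; exact: bigmax_ge_id.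
Qed.

Lemma limit_gauge_le x : C° x -> limit_gauge x <= cratio C x e.
Proof. by move=> Cx; have [? ?] := h_set Cx; exact: h_le. Qed.

(** Since e <= [cratio C e x] x, each G_N x is at least G_N e divided by this ratio, and G_N e is
    eventually positive. *)
Lemma limit_gauge_gt0 x : C° x -> 0 < limit_gauge x.
Proof.
move=> Cx; have r0 : 0 < cratio C e x by exact: cratio_int_gt0.
apply: (@lt_le_trans _ _ (cratio C e x)^-1); first by rewrite invr_gt0.
apply: lb_le_inf; first by eexists; exact: h_set.
move=> c [c0 Hc]; rewrite -div1r ler_pdivrMr//; near \oo => N.
have G1 : 1 <= G N e by near: N; exact: G_unbounded.
have G0 : 0 < G N e by apply: lt_le_trans G1.
have Gx : G N x <= c * G N e by near: N.
have : G N e <= cratio C e x * G N x.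
  by apply: G_le => //; [exact: cone_int_sub|exact: cratio_cone].
move=> /le_trans /(_ (ler_wpM2l (ltW r0) Gx)).
by rewrite mulrA -{1}[G N e]mul1r ler_pM2r// mulrC.
Unshelve. all: by end_near. Qed.

(* If Max had no good reply, compactness of the replies would make the bound on
   [G N] uniform in [b], and the dynamic programming recursion for
   [finite_value] would give a bound on [G N x / G N e] below [h x]; the term
   [k = 0], which escapes the recursion, is negligible as [G N e] diverges. *)
Lemma limit_gauge_step theta x a : 0 < theta -> theta < expR lam -> C° x ->
  exists b, theta * limit_gauge x <= limit_gauge (T a b x).
Proof.
move=> th0 th1 Cx; apply/not_existsP => nH.
have hx0 := limit_gauge_gt0 Cx.
have {}nH b : h (T a b x) < theta * h x by rewrite ltNge; apply/negP/nH.
pose s := theta * h x; have s0 : 0 < s by rewrite mulr_gt0.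
(* The number s' lies strictly between theta h(x) and exp(lam) h(x); the ratio q = s' / s > 1 is the
   slack that absorbs a small change of b. *)
pose s' := (s + expR lam * h x) / 2.
have smu : s < expR lam * h x by rewrite ltr_pM2r.
have ss' : s < s' by rewrite /s'; lra.
have s'mu : s' < expR lam * h x by rewrite /s'; lra.
pose q := s' / s; have q1 : 1 < q by rewrite ltr_pdivlMr// mul1r.
have q0 : 0 < q by exact: lt_trans q1.
have CT b : C° (T a b x) by exact: (dyn_interior gameT).
have unif : \forall N \near \oo,
    [set: B] `<=` [set b | G N (T a b x) <= s' * G N e].
  have /compact_near_coveringP := max_actions_compact gameT.
  apply=> // b _; set y := T a b x.
  (* Replies b' near b satisfy T_ab' x <= q T_ab x, because (q - 1) T_ab x is interior. *)
  have nb : \forall b' \near b, C (q *: y - T a b' x).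
    have Cqy : C° (q *: y - y).
      have -> : q *: y - y = (q - 1) *: y by rewrite scalerBl scale1r.
      by apply: (cone_int_scale properC _ (CT b)); rewrite subr_gt0.
    have Tb : T a b' x @[b' --> b] --> y.
      exact: (dyn_continuous_max gameT (a := a) Cx (x0 := b)).
    exact: (cvgB (cvg_cst (q *: y)) Tb Cqy).
  have nN : \forall N \near \oo, G N y <= s * G N e.
    exact: h_lt (CT b) (nH b).
  exists ([set b' | C (q *: y - T a b' x)], [set N | G N y <= s * G N e]) => //.
  move=> [b' N] [/= Cb' GN].
  apply: (@le_trans _ _ (q * G N y)).
    by apply: G_le => //; exact: cone_int_sub (CT _).
  have -> : s' = q * s by rewrite /q mulfVK// gt_eqF.
  by rewrite -mulrA ler_pM2l.
have nM : \forall N \near \oo, cratio C x e <= s' * expR (- lam) * G N e.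
  have K0 : 0 < s' * expR (- lam) by rewrite mulr_gt0 ?expR_gt0// (lt_trans s0).
  apply: filterS (G_unbounded ((s' * expR (- lam))^-1 * cratio C x e)) => N.
  by rewrite ler_pdivrMl.
have s'0 : 0 <= s' by rewrite ltW// (lt_trans s0).
suff : h x <= s' * expR (- lam).
  by rewrite leNgt expRN ltr_pdivrMr ?expR_gt0// mulrC s'mu.
apply: h_le; first by rewrite mulr_ge0 ?expR_ge0.
near=> N.
have HM : cratio C x e <= s' * expR (- lam) * G N e by near: N.
have HT : [set: B] `<=` [set b | G N (T a b x) <= s' * G N e] by near: N.
have GN0 : 0 <= G N e by exact: bigmax_ge_id.
apply/bigmax_leP; split.
  by rewrite mulr_ge0 // mulr_ge0 ?expR_ge0.
move=> [[|k] kN] _ /=; first by rewrite mulr0 oppr0 expR0 mul1r.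
(* For positive indices, the recursion is bounded by letting Min play [a]; the factor exp(-lam)
   comes from the index shift. *)
have -> : - (lam * k.+1%:R) = - lam - lam * k%:R by rewrite -natr1; ring.
have -> : s' * expR (- lam) * G N e = expR (- lam) * (s' * G N e) by ring.
rewrite expRD -mulrA ler_pM2l ?expR_gt0// expRN ler_pdivrMl ?expR_gt0//.
apply: (mShapley_le properC gameT Ce (a := a)) => //; first exact: cone_int_sub.
move=> b; rewrite -ler_pdivrMl ?expR_gt0// -expRN.
apply: le_trans (HT b I).
exact: (term_le _ (ltnW (kN : (k < N)%N))).
Unshelve. all: by end_near. Qed.

End Subsolution.

(** * The duality theorem *)

Section Duality.
Context (R : realType) (n : nat) (C : set 'rV[R]_n).
Context (A B : topologicalType) (T : A -> B -> 'rV[R]_n -> 'rV[R]_n).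
Context (e : 'rV[R]_n).
Hypotheses (properC : proper_cone C) (gameT : conical_game C T) (Ce : C° e).
Hypothesis n_gt0 : (0 < n)%N.
Context (x0 : 'rV[R]_n) (lam : R).
Hypothesis Cx0 : C° x0.

(** From interior states the images are nonzero, so [ext0] is finite along the play; actions optimal
    up to d suffice. *)
Lemma upper_value_le_dual (v : 'rV[R]_n -> R) : distance_like_on_cone C v ->
  (forall x, (C `\ 0) x -> (Shapley T v x <= lam%:E + (v x)%:E)%E) ->
  (upper_value C T x0 <= lam%:E)%E.
Proof.
move=> dv Sv; apply/lee_addgt0Pr => d d0.
have [x1 [alpha [Cx1 vlb]]] := dl_lower_bound dv.
rewrite -EFinD; apply: (min_guarantee properC gameT n_gt0 Cx0 Cx1 vlb) => x Cx.
have Cx' : (C `\ 0) x.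
  by split; [exact: cone_int_sub|exact/eqP/(cone_int_neq0 properC n_gt0 Cx)].
have : (Shapley T v x < (lam + d + v x)%:E)%E.
  apply: le_lt_trans (Sv x Cx') _; rewrite -EFinD lte_fin; lra.
move=> /ereal_inf_lt[_ [a _ <-]] ltS; exists a => b.
have CT : C° (T a b x) by exact: (dyn_interior gameT).
rewrite -lee_fin; apply: le_trans (ltW ltS).
apply: ereal_sup_ubound; exists b => //.
by rewrite /ext0 (negbTE (cone_int_neq0 properC n_gt0 CT)).
Qed.

(** Take v = ln w. The bound w >= c M makes w positive off 0, so v stays finite on the boundary, and
    gives the lower bound by Funk. *)
Lemma dual_feasible : escape_rate C T e < lam ->
  exists v : 'rV[R]_n -> R, distance_like_on_cone C v /\
    forall x, (C `\ 0) x -> (Shapley T v x <= lam%:E + (v x)%:E)%E.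
Proof.
move=> /(supersolution properC gameT Ce n_gt0)[w [c [gw c0 wM Sw]]].
have w0 x : C x -> x != 0 -> 0 < w x.
  move=> Cx x_neq0; apply: lt_le_trans (wM x Cx); rewrite mulr_gt0//.
  exact: cratio_gt0.
have iC0 x : C° x -> 0 < w x.
  move=> Cx; apply: w0; first exact: cone_int_sub.
  exact: (cone_int_neq0 properC n_gt0 Cx).
exists (fun x => ln (w x)); split; first split.
- apply/subspace_continuousP => x [Cx /eqP x_neq0].
  apply: (@continuous_cvg _ _ _ _ _ w (@ln R)).
    exact: (continuous_ln (w0 x Cx x_neq0)).
  have := proj1 (subspace_continuousP _ _) (gauge_continuous gw) x Cx.
  by apply: cvg_trans; apply: cvg_app; apply: within_subset => y [].
- move=> x y Cx Cy; rewrite -ln_div ?posrE ?iC0//.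
  have r0 : 0 < cratio C x y by exact: cratio_int_gt0.
  rewrite ler_ln ?posrE ?divr_gt0 ?iC0// ler_pdivrMr ?iC0//.
  by apply: (gauge_le gw) => //; [exact: cone_int_sub..|exact: cratio_cone].
- exists e, (ln c); split => // x Cx.
  have r0 : 0 < cratio C x e by exact: cratio_int_gt0.
  rewrite -lnM ?posrE// ler_ln ?posrE ?mulr_gt0 ?iC0//.
  exact: wM (cone_int_sub Cx).
move=> x [Cx /eqP x_neq0]; apply/lee_addgt0Pr => d d0.
have wx0 := w0 x Cx x_neq0.
have : mShapley T w x < expR (lam + ln (w x) + d).
  apply: le_lt_trans (Sw x Cx) _.
  rewrite -{1}(lnK (_ : w x \is Num.pos)) ?posrE//.
  by rewrite -expRD ltr_expR ltrDl.
move=> /(mShapley_lt properC gameT Ce gw Cx)[a Ha].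
apply: (@le_trans _ _ (ereal_sup [set ext0 (fun x => ln (w x)) (T a b x)
    | b in [set: B]])).
  by apply: ereal_inf_lbound; exists a.
apply: ge_ereal_sup => _ [b _ <-]; rewrite /ext0; case: eqVneq => [|T0].
  (* If T_ab x = 0, the convention v(0) = -oo makes the bound trivial. *)
  by rewrite leNye.
rewrite -!EFinD lee_fin -ler_expR lnK ?posrE ?w0//; first exact: ltW.
exact: (dyn_cone gameT).
Qed.

(** The subsolution is built for a rate l strictly above lam, because the step inequality holds only
    for theta < exp(l); theta = exp(lam) qualifies. *)
Lemma le_lower_value : lam < escape_rate C T e ->
  (lam%:E <= lower_value C T x0)%E.
Proof.
move=> lt; pose l := (lam + escape_rate C T e) / 2.
have l1 : lam < l by rewrite /l; lra.
have l2 : l < escape_rate C T e by rewrite /l; lra.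
pose h := limit_gauge C T e l.
have h0 x : C° x -> 0 < h x by exact: limit_gauge_gt0.
apply: (max_guarantee (v := fun x => ln (h x)) (alpha := 0)
  properC gameT n_gt0 Cx0 Ce) => [x Cx|x a Cx].
  rewrite add0r ler_ln ?posrE ?h0//; last exact: cratio_int_gt0.
  exact: limit_gauge_le.
have el : expR lam < expR l by rewrite ltr_expR.
have [b Hb] := limit_gauge_step properC gameT Ce n_gt0 l2 a
  (expR_gt0 lam) el Cx.
exists b; rewrite -{1}(expRK lam) -lnM ?posrE ?expR_gt0 ?h0//.
rewrite ler_ln ?posrE ?mulr_gt0 ?expR_gt0 ?h0//.
exact: (dyn_interior gameT).
Qed.

End Duality.

Theorem corollary33 (R : realType) (n : nat) (C : set 'rV[R]_n)
    (A B : topologicalType) (T : A -> B -> 'rV[R]_n -> 'rV[R]_n)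
    (n_gt0 : (0 < n)%N) (properC : proper_cone C) (gameT : conical_game C T) :
  exists rho : R,
    is_value C T rho /\
    rho%:E = ereal_inf [set lambda%:E | lambda in
      [set lambda : R | exists v : 'rV[R]_n -> R,
        distance_like_on_cone C v /\
        forall x : 'rV[R]_n, (C `\ 0) x ->
          (Shapley T v x <= lambda%:E + (v x)%:E)%E]].
Proof.
have [e Ce] := cone_interior properC.
(* The rate at one fixed [e] serves every initial state, since both bounds below hold for each
   x0. *)
pose rho := escape_rate C T e; exists rho.
have value : is_value C T rho.
  move=> x0 Cx0.
  have up : (upper_value C T x0 <= rho%:E)%E.
    apply/lee_addgt0Pr => d d0; rewrite -EFinD.
    have [|v [dv Sv]] := dual_feasible properC gameT Ce n_gt0 (lam := rho + d).
      by rewrite ltrDl.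
    exact: upper_value_le_dual dv Sv.
  have low : (rho%:E <= lower_value C T x0)%E.
    apply/lee_subgt0Pr => d d0; rewrite -EFinB.
    apply: (le_lower_value properC gameT Ce n_gt0 Cx0).
    by rewrite ltrBlDr ltrDl.
  have lu := lower_value_le_upper C T x0.
  split; apply/eqP; rewrite eq_le.
    by rewrite up (le_trans low lu).
  by rewrite low (le_trans lu up).
split=> //; apply/eqP; rewrite eq_le; apply/andP; split.
  apply: le_ereal_inf_tmp => _ [lam [v [dv Sv]] <-].
  have [<- _] := value e Ce; exact: upper_value_le_dual dv Sv.
apply/lee_addgt0Pr => d d0; apply: ereal_inf_lbound; exists (rho + d) => //.
by apply: (dual_feasible properC gameT Ce n_gt0); rewrite ltrDl.
Qed.
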